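(* Let $G$ be a finite group and $p$ a prime. Then $$\widetilde{OGF}(p,G\wr A,x) = \widetilde{OGF}(p,A,x)^{\tilde r(p,G)}.$$
   Context: For a finite group $H$ and a prime $p$, $\tilde r(p,H)$ is the number of conjugacy classes of $H$ whose elements have order $p^d$ for some $d\ge0$. Generating functions are formal power series: $\widetilde{OGF}(p,A,x)=\sum_{n\ge0}\tilde r(p,S_n)x^n$ for the symmetric groups $S_n$ (with $S_0$ trivial), and $\widetilde{OGF}(p,G\wr A,x)=\sum_{n\ge0}\tilde r(p,G\wr S_n)x^n$, where $G\wr S_n = G^n\rtimes S_n$ is the wreath product (trivial for $n=0$). *)

(* Defs.v *)
From HB Require Import structures.
From mathcomp Require Import all_boot all_order all_algebra.
From mathcomp Require Import all_fingroup all_solvable.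

Set Implicit Arguments.
Unset Strict Implicit.
Unset Printing Implicit Defensive.

Import GRing.Theory.

Section PElementClasses.
Local Open Scope group_scope.

Definition num_pclasses (p : nat) (gT : finGroupType) (H : {group gT}) : nat :=
  #|[set C in classes H | [forall x in C, p.-elt x]]|.

Lemma p_eltP (p : nat) (gT : finGroupType) (x : gT) : prime p ->
  reflect (exists d : nat, #[x] = (p ^ d)%N) (p.-elt x).
Proof.
move=> p_pr; apply: (iffP idP) => [/p_natP[d ->] | [d xd]]; first by exists d.
by rewrite /p_elt xd pnatX pnat_id.
Qed.

End PElementClasses.

Section WreathProduct.
Local Open Scope group_scope.
Variables (gT : finGroupType) (n : nat).

(* The direct power of gT; the dependent form of the function type is the one
   carrying the pointwise group structure. *)
Definition wreath_base : finGroupType := {dffun forall i : 'I_n, gT}.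

(* Permutations compose from left to right, so the inverse is what makes this
   a right action. *)
Definition wreath_perm (f : wreath_base) (s : 'S_n) : wreath_base :=
  [ffun i => f (s^-1 i)].

Lemma wreath_perm_is_action : is_action [set: 'S_n] wreath_perm.
Proof.
split=> [s f g fg | f s t _ _]; apply/ffunP=> i.
  by move/ffunP/(_ (s i)): fg; rewrite !ffunE permK.
by rewrite !ffunE invMg permM.
Qed.

Definition wreath_action := Action wreath_perm_is_action.

Lemma wreath_action_is_groupAction :
  is_groupAction [set: wreath_base] wreath_action.
Proof.
move=> s _; rewrite inE; apply/andP; split; first by apply/subsetP=> f; rewrite inE.
apply/morphicP=> f g _ _; rewrite !actpermE /=.
by apply/ffunP=> i; rewrite !ffunE.
Qed.

Definition wreath_groupAction := GroupAction wreath_action_is_groupAction.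

Definition wreath : finGroupType := sdprod_by wreath_groupAction.

End WreathProduct.

Section FormalPowerSeries.
Local Open Scope ring_scope.
Variable R : pzSemiRingType.

(* The function f stands for the formal power series \sum_n f n x^n. *)
Definition fps := nat -> R.

Definition fps_one : fps := fun n => (n == 0%N)%:R.

Definition fps_mul (f g : fps) : fps :=
  fun n => \sum_(i < n.+1) f i * g (n - i)%N.

Definition fps_exp (f : fps) (m : nat) : fps := iter m (fps_mul f) fps_one.

End FormalPowerSeries.

Definition ogf_sym (p : nat) : fps int :=
  fun n => (num_pclasses p [set: 'S_n]%G)%:R%R.

Definition ogf_wreath (p : nat) (gT : finGroupType) : fps int :=
  fun n => (num_pclasses p [set: wreath gT n]%G)%:R%R.

(* Main.v *)
Require Import Defs.
From mathcomp Require Import all_boot all_order all_algebra.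
From mathcomp Require Import all_fingroup all_solvable.

Set Implicit Arguments.
Unset Strict Implicit.
Unset Printing Implicit Defensive.
Import GroupScope.

(** The conjugacy classes of G wr S_n are classified by coloured cycle types.
    Regard an element of G wr S_n as a permutation of n points whose arrows
    i -> s i carry labels in G.  Going once round the cycle of i and multiplying
    the labels gives the cycle product at i.  Conjugation renames the points and
    changes the labels by a gauge transformation, so it keeps the cycle lengths
    and moves each cycle product inside its conjugacy class.  Hence the number of
    points lying on a cycle of length l with product in a class C depends only
    on the conjugacy class, and these numbers determine it ([wreath_conjP]): two
    elements with the same numbers are matched cycle by cycle.

    An element is a p-element iff each of its cycles has length a power of p and
    a product that is a p-element of G ([pelt_wreath]).  So the p-classes of
    G wr S_n correspond to the functions m that give to every p-class C of G and
    every exponent d a multiplicity m C d, with \sum_(C, d) p ^ d * m C d = n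
    ([num_pclasses_wreath]); all of them occur ([ex_wreath_cycles]).

    Such a function is a family, indexed by the p-classes of G, of partitions
    into powers of p.  Let P be the generating function of these partitions.
    Expanding the product of one copy of P for each p-class C shows that the
    generating function of the wreath products of G is P to the number of
    p-classes of G.  For a trivial group the exponent is 1 and the wreath product
    is S_n, so P is the generating function of the symmetric groups, and the
    theorem follows.

    To count up to degree N it is enough to let exponents and multiplicities run
    over 0, ..., N, which makes P a polynomial and all index sets finite. *)

(** * Elements of the wreath product as labelled permutations *)

Section Labels.
Variables (gT : finGroupType) (n : nat).
Implicit Types (u v w : wreath gT n) (i j : 'I_n).

Definition top w : 'S_n := (pair_of_sd w).1.

(** The base component of a product is (x acted on by b) * y, and b acts by moving
    coordinate i to b i; reading the coordinate at the end of the arrow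
    i -> top w i is therefore what makes labels multiply along paths, as in
    [labelM]. *)
Definition label w i : gT := ((pair_of_sd w).2 : wreath_base gT n) (top w i).

Lemma wreath_of_subproof (s : 'S_n) (f : wreath_base gT n) :
  (s, f) \in setX [set: 'S_n] [set: wreath_base gT n].
Proof. by rewrite !inE. Qed.

Definition wreath_of (s : 'S_n) (f : 'I_n -> gT) : wreath gT n :=
  SdPair (wreath_groupAction gT n) (wreath_of_subproof s [ffun i => f (s^-1 i)]).

Lemma top_wreath_of s f : top (wreath_of s f) = s.
Proof. by []. Qed.

Lemma label_wreath_of s f i : label (wreath_of s f) i = f i.
Proof. by rewrite /label top_wreath_of ffunE permK. Qed.

Lemma wreath_eq u v : top u =1 top v -> label u =1 label v -> u = v.
Proof.
move=> /permP tuv luv; apply: val_inj.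
have e2: (pair_of_sd u).2 = (pair_of_sd v).2.
  apply/ffunP => i; have := luv ((top u)^-1 i).
  by rewrite /label -tuv permKV.
move: tuv e2; rewrite /top /=.
by case: (pair_of_sd u) (pair_of_sd v) => a b [c d] /= -> ->.
Qed.

Lemma label1 i : label 1 i = 1 :> gT.
Proof. by rewrite /label ffunE. Qed.

Lemma topM u v : top (u * v) = top u * top v. Proof. by []. Qed.

Lemma labelM u v i : label (u * v) i = label u i * label v (top u i).
Proof. by rewrite /label topM /= !ffunE permM permK. Qed.

Lemma topX w k : top (w ^+ k) = top w ^+ k.
Proof. by elim: k => // k IH; rewrite !expgS topM IH. Qed.

Lemma topXE w k i : top (w ^+ k) i = iter k (top w) i.
Proof. by rewrite topX permX. Qed.

(** Iterating a closed path multiplies its label with itself. *)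
Lemma label_pow_stable w k m i : top (w ^+ k) i = i ->
  label (w ^+ (k * m)) i = label (w ^+ k) i ^+ m.
Proof.
move=> fix_i; elim: m => [|m IH]; first by rewrite muln0 label1.
by rewrite mulnS expgD labelM fix_i IH expgS.
Qed.

Definition len w i : nat := fingraph.order (top w) i.

(** The cycle product, read off from the power of w that first returns to i. *)
Definition cyc w i : gT := label (w ^+ len w i) i.

Lemma top_len w i : top (w ^+ len w i) i = i.
Proof. by rewrite topXE iter_order //; apply: perm_inj. Qed.

Lemma top_fixP w k i : (top (w ^+ k) i == i) = (len w i %| k).
Proof.
have fixM m : top (w ^+ (len w i * m)) i = i.
  elim: m => [|m IH]; first by rewrite muln0 perm1.
  by rewrite mulnS expgD topM permM top_len.
apply/eqP/dvdnP => [|[m ->]]; last by rewrite mulnC fixM.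
rewrite {1}(divn_eq k (len w i)) mulnC expgD topM permM fixM => fix_r.
exists (k %/ len w i); rewrite {1}(divn_eq k (len w i)).
have lt_r: k %% len w i < len w i by rewrite ltn_mod fingraph.order_gt0.
have := findex_iter lt_r; rewrite -topXE fix_r findex0 => <-.
by rewrite addn0.
Qed.

(** If w ^ (p ^ d) = 1, each cycle length l divides p ^ d, and raising the cycle
    product to the power p ^ d / l gives 1.  Conversely each point i has some
    power of p at which w both returns to i and has label 1 there; the largest
    of these powers kills w. *)
Lemma pelt_wreath p w : prime p ->
  p.-elt w = [forall i, p.-nat (len w i) && p.-elt (cyc w i)].
Proof.
move=> p_pr; apply/(p_eltP _ p_pr)/forallP => [[d wd] i | pw].
  have w1: w ^+ (p ^ d)%N = 1 by rewrite -wd expg_order.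
  have: top (w ^+ (p ^ d)%N) i == i by rewrite w1 perm1.
  rewrite top_fixP => /dvdnP[m e_pd].
  have p_pd: p.-nat (p ^ d)%N by rewrite pnatX pnat_id.
  have: label (w ^+ (p ^ d)%N) i = 1 by rewrite w1 label1.
  rewrite e_pd mulnC label_pow_stable ?top_len // -/(cyc w i) => cyc_m.
  rewrite e_pd pnatM in p_pd; case/andP: p_pd => pm ->.
  by apply: pnat_dvd pm; rewrite order_dvdn cyc_m.
have [e he]: exists e : 'I_n -> nat, forall i,
    (top (w ^+ (p ^ e i)%N) i == i) && (label (w ^+ (p ^ e i)%N) i == 1).
  have ex i : exists e : nat,
      (top (w ^+ (p ^ e)%N) i == i) && (label (w ^+ (p ^ e)%N) i == 1).
    have /andP[/p_natP[a len_a] /p_natP[b cyc_b]] := pw i.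
    exists (a + b)%N; rewrite top_fixP expnD -len_a dvdn_mulr //=.
    by rewrite label_pow_stable ?top_len // -/(cyc w i) -cyc_b expg_order.
  by exists (fun i => xchoose (ex i)) => i; apply: xchooseP (ex i).
pose E := \max_i e i.
suff wE: w ^+ (p ^ E)%N = 1.
  have : #[w] %| (p ^ E)%N by rewrite order_dvdn wE.
  by move=> /(dvdn_pfactor _ _ p_pr)[d _ ->]; exists d.
apply: wreath_eq => i.
  apply/eqP; rewrite perm1 top_fixP; have /andP[] := he i; rewrite top_fixP => h _.
  by apply: dvdn_trans h _; rewrite dvdn_exp2l ?leq_bigmax.
rewrite label1; have /andP[/eqP ht /eqP hl] := he i.
rewrite -(subnKC (leq_bigmax i : e i <= E)) expnD label_pow_stable //.
by rewrite hl expg1n.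
Qed.

End Labels.

(** * The conjugacy classes of the wreath product *)

Section Conjugacy.
Variables (gT : finGroupType) (n : nat).
Implicit Types (u v w : wreath gT n) (i j : 'I_n) (A : {set 'I_n}).
Implicit Types (b : 'I_n -> 'I_n) (h : 'I_n -> gT).

(** A conjugation of w into w' that is defined only on the w-invariant set A:
    b renames the points and h is the change of gauge. *)
Definition intertwines w w' A b h : Prop :=
  [/\ {in A, forall i, top w i \in A}, {in A &, injective b},
      {in A, forall i, b (top w i) = top w' (b i)}
    & {in A, forall i, label w i * h (top w i) = h i * label w' (b i)}].

Definition pts w (l : nat) (C : {set gT}) : {set 'I_n} :=
  [set i | (len w i == l) && (cyc w i \in C)].

Section Intertwiner.
Variables (w w' : wreath gT n) (A : {set 'I_n}).
Variables (b : 'I_n -> 'I_n) (h : 'I_n -> gT).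
Hypothesis iwt : intertwines w w' A b h.

Lemma intertwinesX k i : i \in A ->
  [/\ top (w ^+ k) i \in A, b (top (w ^+ k) i) = top (w' ^+ k) (b i)
    & label (w ^+ k) i * h (top (w ^+ k) i) = h i * label (w' ^+ k) (b i)].
Proof.
have [sA _ bw hw] := iwt => Ai; elim: k => [|k [IHA IHb IHh]].
  by rewrite !perm1 !label1 mulg1 mul1g.
rewrite !expgSr !topM !permM !labelM sA // bw // IHb; split=> //.
by rewrite -mulgA hw // mulgA IHh IHb -mulgA.
Qed.

Lemma len_intertwines i : i \in A -> len w' (b i) = len w i.
Proof.
move=> Ai; have [_ inj_b _ _] := iwt.
have eqd k : (len w' (b i) %| k) = (len w i %| k).
  rewrite -!top_fixP; have [wA wb _] := intertwinesX k Ai.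
  by rewrite -wb (inj_in_eq inj_b).
by apply/eqP; rewrite eqn_dvd eqd dvdnn -eqd dvdnn.
Qed.

Lemma cyc_intertwines i : i \in A -> cyc w' (b i) = cyc w i ^ h i.
Proof.
move=> Ai; rewrite /cyc len_intertwines // conjgE.
have [_ _ e] := intertwinesX (len w i) Ai.
by rewrite top_len in e; rewrite e mulKg.
Qed.

Lemma pts_intertwines l g i : i \in A ->
  (b i \in pts w' l (g ^: [set: gT])) = (i \in pts w l (g ^: [set: gT])).
Proof.
move=> Ai; rewrite !inE len_intertwines // cyc_intertwines //; congr (_ && _).
by rewrite -{1}(classGidr g (in_setT (h i)) : _ :^ _ = g ^: [set: gT]) memJ_conjg.
Qed.

End Intertwiner.

Lemma conj_intertwines w v : intertwines w (w ^ v) setT (top v) (label v).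
Proof.
have e : w * v = v * w ^ v by rewrite conjgE mulKVg.
split=> [i|i j _ _|i _|i _]; rewrite ?inE //; first exact: perm_inj.
  by rewrite -!permM -!topM e.
by rewrite -!labelM e.
Qed.

Lemma cyc_topX w m i : cyc w (top (w ^+ m) i) = cyc w i ^ label (w ^+ m) i.
Proof.
have := conj_intertwines w (w ^+ m); rewrite conjgE -expgS expgSr mulKg => iwt.
by rewrite (cyc_intertwines iwt) ?inE.
Qed.

Lemma intertwines_conj w w' b h : intertwines w w' setT b h ->
  exists v, w' = w ^ v.
Proof.
case=> _ inj_b bw hw.
have injb : injective b by move=> i j; apply: inj_b; rewrite inE.
exists (wreath_of (perm injb) h); set v := wreath_of _ _.
apply: (mulgI v); rewrite conjgE mulKVg.
have topv : top v =1 b by move=> i; rewrite top_wreath_of permE.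
apply: wreath_eq => i.
  by rewrite !topM !permM !topv bw ?inE.
by rewrite !labelM !topv !label_wreath_of hw ?inE.
Qed.

(** The new points are those of the w-cycle O of i, sent to the w'-cycle of i'.
    At m steps from i the gauge is forced to be F m: the inverse of the label of
    the path from i, then g, then the label of the path from i'.  Going once
    round the cycle gives back F 0 = g because g conjugates one cycle product
    into the other. *)
Lemma intertwines_extend w w' A b h i i' : intertwines w w' A b h ->
    i \notin A -> i' \notin b @: A -> len w' i' = len w i ->
    cyc w' i' \in cyc w i ^: [set: gT] ->
  exists A' b' h', intertwines w w' A' b' h' /\ i |: A \subset A'.
Proof.
move=> iwt nAi nAi' eq_len /imsetP[g _ eq_cyc].
have [sA inj_b bw hw] := iwt.
pose O := [set j | fconnect (top w) i j].
pose k j := findex (top w) i j.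
pose b' j := if j \in O then top (w' ^+ k j) i' else b j.
pose F m := (label (w ^+ m) i)^-1 * g * label (w' ^+ m) i'.
pose h' j := if j \in O then F (k j) else h j.
have tk j : j \in O -> top (w ^+ k j) i = j.
  by rewrite inE topXE => /iter_findex.
have k_lt j : j \in O -> k j < len w i by rewrite inE => /findex_max.
have sO j : j \in O -> top w j \in O.
  by rewrite !inE => ij; apply: connect_trans ij (fconnect1 _ _).
have kS j : j \in O -> k (top w j) = if (k j).+1 == len w i then 0 else (k j).+1.
  move=> Oj; have lt_k := k_lt j Oj; rewrite -{1}[j]tk // -permM -topM -expgSr.
  case: eqP => [->|/eqP ne]; first by rewrite top_len /k findex0.
  by rewrite topXE /k findex_iter // ltn_neqAle ne.
(* A is invariant, so it cannot meet the cycle of i without containing i. *)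
have nAO j : j \in A -> (j \in O) = false.
  move=> Aj; apply/negbTE; apply: contra nAi => Oj.
  rewrite -[i](top_len w).
  have lt_k := k_lt j Oj; rewrite -(subnKC (ltnW lt_k)) expgD topM permM tk //.
  by case: (intertwinesX iwt (len w i - k j) Aj).
(* Likewise the image of A is w'-invariant and misses the cycle of i'. *)
have nAtop j m : j \in A -> top (w' ^+ m) i' <> b j.
  move=> Aj e; case/negP: nAi'.
  have : top (w' ^+ (m * (len w' i').-1)) (b j) = i'.
    rewrite -e -permM -topM -expgD -mulnS prednK ?fingraph.order_gt0 //.
    by apply/eqP; rewrite top_fixP dvdn_mull.
  have [wA <- _] := intertwinesX iwt (m * (len w' i').-1) Aj.
  by move=> <-; apply: imset_f.
exists (O :|: A), b', h'; split; last first.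
  by rewrite setSU // sub1set inE connect0.
split.
- move=> j /setUP[/sO Oj|/sA Aj]; first by rewrite inE Oj.
  by rewrite inE Aj orbT.
- move=> j1 j2 /setUP[O1|A1] /setUP[O2|A2]; rewrite /b'.
  + rewrite O1 O2 => e; rewrite -[j1]tk // -[j2]tk //.
    have lt1 := k_lt _ O1; have lt2 := k_lt _ O2.
    move: e; rewrite !topXE => e.
    have := findex_iter (f := top w') (x := i') (i := k j1).
    rewrite -/(len w' i') eq_len => /(_ lt1) <-.
    by rewrite e findex_iter // -/(len w' i') eq_len.
  + by rewrite O1 nAO // => /nAtop-/(_ A2).
  + by rewrite O2 nAO // => /esym/nAtop-/(_ A1).
  + by rewrite !nAO //; apply: inj_b.
- move=> j /setUP[Oj|Aj]; rewrite /b'; last by rewrite !nAO ?sA // bw.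
  rewrite sO // Oj kS // -permM -topM -expgSr.
  by case: eqP => // ->; rewrite -eq_len top_len perm1.
move=> j /setUP[Oj|Aj]; rewrite /b' /h'; last by rewrite !nAO ?sA // hw.
rewrite sO // Oj kS //.
have FS : label w j * F (k j).+1 = F (k j) * label w' (top (w' ^+ k j) i').
  by rewrite /F !expgSr !labelM tk // invMg !mulgA mulgV mul1g.
case: eqP => [e|_]; last exact: FS.
rewrite -FS; congr (_ * _); rewrite e /F -/(cyc w i) -eq_len -/(cyc w' i').
by rewrite eq_cyc !label1 invg1 mul1g mulg1 conjgE !mulgA mulgK mulVg mul1g.
Qed.

(** Start from the empty intertwiner and extend it one cycle at a time.  A new
    point i always finds a partner i' outside the image of A: the intertwiner
    pairs the points of A of the same type as i with those of its image, and
    there are equally many points of that type for w and for w'. *)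
Theorem wreath_conjP w w' :
  reflect (forall l C, C \in classes [set: gT] -> #|pts w' l C| = #|pts w l C|)
          (w' \in w ^: [set: wreath gT n]).
Proof.
apply: (iffP idP) => [/imsetP[v _ ->] l _ /imsetP[g _ ->]|eq_pts].
  rewrite -(card_imset (pts w l _) (@perm_inj _ (top v))); apply: eq_card => j.
  rewrite -[j](permKV (top v)) (mem_imset _ _ (@perm_inj _ (top v))).
  exact: (pts_intertwines (conj_intertwines w v) _ _ (in_setT _)).
suff [b [h iwt]]: exists b h, intertwines w w' setT b h.
  by have [v ->] := intertwines_conj iwt; rewrite memJ_class ?inE.
suff extend_all m A b h : intertwines w w' A b h -> #|~: A| <= m ->
    exists b h, intertwines w w' setT b h.
  by apply: (extend_all _ set0 id (fun=> 1) _ (leqnn _)); split=> i; rewrite inE.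
elim: m A b h => [|m IH] A b h iwt leA.
  have A0 : ~: A = set0 by apply/eqP; rewrite -cards_eq0 -leqn0.
  by exists b, h; rewrite -setC0 -A0 setCK.
have [/eqP AT|] := boolP (A == setT); first by exists b, h; rewrite -AT.
rewrite -subTset => /subsetPn[i _ nAi].
pose D := pts w (len w i) (cyc w i ^: setT).
pose D' := pts w' (len w i) (cyc w i ^: setT).
have Di : i \in D by rewrite inE eqxx class_refl.
have [i' D'i' nAi'] : exists2 i', i' \in D' & i' \notin b @: A.
  apply/subsetPn/negP => /subsetP sD'.
  have sD : D' \subset b @: (A :&: D).
    apply/subsetP=> j D'j; have /imsetP[j0 Aj0 ej] := sD' j D'j.
    apply/imsetP; exists j0; rewrite // inE Aj0 /= -(pts_intertwines iwt) //.
    by rewrite -ej.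
  have := leq_trans (subset_leq_card sD) (leq_imset_card _ _).
  rewrite eq_pts ?mem_classes ?inE // -/D.
  move=> leD; have eAD : A :&: D = D.
    by apply/eqP; rewrite eqEcard subsetIr leD.
  have /setIP[Ai _] : i \in A :&: D by rewrite eAD.
  by rewrite Ai in nAi.
have [/eqP eq_len cycC] := andP (etrans (esym (in_set _ _)) D'i').
have [A' [b' [h' [iwt' sA']]]] := intertwines_extend iwt nAi nAi' eq_len cycC.
apply: (IH A' b' h') => //; rewrite -ltnS; apply: leq_trans leA.
apply: proper_card; rewrite properC; apply: proper_sub_trans sA'.
by rewrite properUr // sub1set.
Qed.

End Conjugacy.

(** * Elements with prescribed cycles *)

Section Cycles.
Variables (gT : finGroupType) (n : nat).
Implicit Types (w : wreath gT n) (i : 'I_n).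

(** The points counted form a union of cycles of length l. *)
Lemma dvdn_card_pts w l C : C \in classes [set: gT] -> l %| #|pts w l C|.
Proof.
case/imsetP=> g _ ->; have inj_w : injective (top w) by apply: perm_inj.
rewrite -(fcard_order_set inj_w (n := l) (a := pts w l (g ^: [set: gT]))).
- exact: dvdn_mull.
- by apply/subsetP=> i; rewrite !inE => /andP[].
move=> i _ /eqP <-; have := conj_intertwines w w; rewrite conjgE mulKg => iwt.
by rewrite (pts_intertwines iwt) ?inE.
Qed.

Lemma ex_wreath_on (T : finType) (s : T -> T) (f : T -> gT) :
    #|T| = n -> injective s ->
  exists w (c : 'I_n -> T), [/\ bijective c,
    forall i, c (top w i) = s (c i) & forall i, label w i = f (c i)].
Proof.
move=> cardT inj_s; pose c i : T := enum_val (cast_ord (esym cardT) i).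
pose c' t := cast_ord cardT (enum_rank t).
have cK : cancel c c' by move=> i; rewrite /c' enum_valK cast_ordKV.
have c'K : cancel c' c by move=> i; rewrite /c cast_ordK enum_rankK.
have inj_r : injective (fun i => c' (s (c i))).
  by move=> i j /(can_inj c'K)/inj_s/(can_inj cK).
exists (wreath_of (perm inj_r) (f \o c)), c; split; first by exists c'.
  by move=> i; rewrite top_wreath_of permE c'K.
by move=> i; rewrite label_wreath_of.
Qed.

(** Take the disjoint union of the cycles Z / l j, put the label g j on the arrow
    that leaves 0 and the label 1 on all the others.  The cycle product is g j at
    the point 0, hence a conjugate of g j elsewhere on the same cycle. *)
Lemma ex_wreath_cycles (J : finType) (l : J -> nat) (g : J -> gT) :
    (forall j, 0 < l j) -> \sum_j l j = n ->
  exists w (k : 'I_n -> J), [/\ forall i, len w i = l (k i),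
    forall i, cyc w i \in g (k i) ^: [set: gT] & forall j, #|[set i | k i == j]| = l j].
Proof.
move=> l_gt0 sum_l.
pose T := {j : J & 'I_(l j)}.
pose s (t : T) : T := Tagged (fun j => 'I_(l j)) (ordS (tagged t)).
pose f (t : T) := if val (tagged t) == 0 then g (tag t) else 1.
have cardT : #|{: T}| = n.
  rewrite card_tagged sumnE big_map big_enum -sum_l.
  by apply: eq_bigr => j _; rewrite card_ord.
have inj_s : injective s.
  move=> [j x] [j' x'] e; have ejj := congr1 tag e; rewrite /= in ejj.
  by subst j'; move/eqP: e; rewrite eq_Tagged /= => /eqP/ordS_inj ->.
have T_eq (t t' : T) : tag t = tag t' ->
    val (tagged t) = val (tagged t') -> t = t'.
  by case: t t' => [j x] [j' x'] /= e; subst j'; move=> /val_inj ->.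
have iter_s m t : tag (iter m s t) = tag t /\
    val (tagged (iter m s t)) = (val (tagged t) + m) %% l (tag t).
  elim: m => [|m [IHt IHv]] /=; first by rewrite addn0 modn_small.
  by rewrite IHv IHt -addn1 modnDml -addnA addn1.
have [w [c [bij_c cs cf]]] := ex_wreath_on f cardT inj_s.
have cX m i : c (top (w ^+ m) i) = iter m s (c i).
  by rewrite topXE; elim: m => //= m IH; rewrite cs IH.
have inj_c := bij_inj bij_c.
have len_w i : len w i = l (tag (c i)).
  have eqd m : (len w i %| m) = (l (tag (c i)) %| m).
    rewrite -top_fixP -(inj_eq inj_c) cX.
    have [t_m v_m] := iter_s m (c i).
    have -> : (iter m s (c i) == c i) =
              ((val (tagged (c i)) + m) %% l (tag (c i)) == val (tagged (c i))).
      rewrite -v_m; apply/eqP/eqP => [-> //|]; exact: T_eq.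
    have lt_c := ltn_ord (tagged (c i)).
    by rewrite -[X in _ == X](modn_small lt_c) -[X in _ == X %% _]addn0 eqn_modDl mod0n.
  by apply/eqP; rewrite eqn_dvd eqd dvdnn -eqd dvdnn.
exists w, (tag \o c); split=> // [i|j] /=.
  (* From i, m steps lead to the point o at position 0 of the same cycle. *)
  pose m := l (tag (c i)) - val (tagged (c i)).
  pose o := top (w ^+ m) i.
  have [tag_o val_o] : tag (c o) = tag (c i) /\ val (tagged (c o)) = 0.
    have := iter_s m (c i); rewrite -cX => -[tag_m val_m]; split=> //.
    by rewrite val_m /m (subnKC (ltnW (ltn_ord (tagged (c i))))) modnn.
  have label_o r : r < l (tag (c i)) -> label (w ^+ r.+1) o = g (tag (c i)).
    elim: r => [|r IH] lt_r; first by rewrite expg1 cf /f val_o eqxx tag_o.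
    rewrite expgSr labelM IH 1?ltnW // cf cX /f.
    have [_ ->] := iter_s r.+1 (c o).
    by rewrite val_o tag_o modn_small // mulg1.
  have cyc_o : cyc w o = g (tag (c i)).
    rewrite /cyc len_w tag_o -(prednK (l_gt0 (tag (c i)))).
    by rewrite label_o // prednK.
  by rewrite -cyc_o cyc_topX class_sym memJ_class ?inE.
have -> : [set i | tag (c i) == j] = c @^-1: [set t | tag t == j].
  by apply/setP=> i; rewrite !inE.
rewrite (on_card_preimset (onW_bij _ bij_c)) cardsE.
rewrite -(card_ord (l j)) (bij_eq_card (tag_with_bij (fun j => 'I_(l j)) j)).
by rewrite card_sig.
Qed.

End Cycles.

(** * Counting classes of p-elements *)

Section PClasses.
Variable p : nat.

Definition pclasses (aT : finGroupType) : {set {set aT}} :=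
  [set C in classes [set: aT] | [forall x in C, p.-elt x]].

Lemma mem_pclasses (aT : finGroupType) (x : aT) :
  (x ^: [set: aT] \in pclasses aT) = p.-elt x.
Proof.
rewrite inE mem_classes ?inE //=; apply/forall_inP/idP => [h|px _ /imsetP[y _ ->]].
  exact: h (class_refl _ _).
by rewrite p_eltJ.
Qed.

Lemma classes_eq (aT : finGroupType) (C D : {set aT}) (x : aT) :
    C \in classes [set: aT] -> D \in classes [set: aT] ->
  x \in C -> x \in D -> C = D.
Proof. by move=> /imsetP[y _ ->] /imsetP[z _ ->] /class_eqP <- /class_eqP. Qed.

Lemma class_repr (aT : finGroupType) (C : {set aT}) :
  C \in classes [set: aT] -> repr C ^: [set: aT] = C.
Proof.
by case/imsetP=> x _ ->; apply/class_eqP; apply: mem_repr (class_refl _ _).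
Qed.

Lemma num_pclasses_invariant (aT : finGroupType) (B : finType) (t : aT -> B)
    (D : {set B}) :
    (forall x, p.-elt x -> t x \in D) ->
    (forall x y, p.-elt x -> p.-elt y ->
       (t x == t y) = (y \in x ^: [set: aT])) ->
    (forall b, b \in D -> exists2 x, p.-elt x & t x = b) ->
  num_pclasses p [set: aT] = #|D|.
Proof.
move=> tD t_eq t_onto; rewrite /num_pclasses -/(pclasses aT).
have p_repr C : C \in pclasses aT -> p.-elt (repr C) /\ C = repr C ^: [set: aT].
  rewrite inE => /andP[classC /forall_inP pC]; split; last by rewrite class_repr.
  by have /imsetP[x _ e] := classC; apply: pC; rewrite e (mem_repr x) ?class_refl.
rewrite -(card_in_imset (f := t \o repr)) => [|C1 C2 /p_repr[p1 e1] /p_repr[p2 e2] /eqP].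
  apply: eq_card => b; apply/imsetP/idP => [[C /p_repr[pC _] ->]|/t_onto[x px <-]].
    exact: tD.
  have xC : x ^: [set: aT] \in pclasses aT by rewrite mem_pclasses.
  exists (x ^: [set: aT]) => //=; have [pC eC] := p_repr _ xC.
  by apply/eqP; rewrite /= eq_sym t_eq // -eC class_refl.
by rewrite /= t_eq // => /class_eqP e; rewrite e1 e2 e.
Qed.

Lemma num_pclasses_bij_morph (aT rT : finGroupType) (f : aT -> rT) :
  {morph f : x y / x * y} -> bijective f ->
  num_pclasses p [set: aT] = num_pclasses p [set: rT].
Proof.
move=> fM bij_f; have inj_f := bij_inj bij_f; have [f' fK f'K] := bij_f.
have f1 : f 1 = 1 by apply: (mulgI (f 1)); rewrite -fM !mulg1.
have fX x k : f (x ^+ k) = f x ^+ k.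
  by elim: k => // k IH; rewrite !expgS fM IH.
have fJ x y : f (x ^ y) = f x ^ f y.
  by apply: (mulgI (f y)); rewrite -fM !conjgE !mulKVg fM.
have f_elt x : p.-elt (f x) = p.-elt x.
  rewrite /p_elt; suff -> : #[f x] = #[x] by [].
  have fX1 k : (f x ^+ k == 1) = (x ^+ k == 1) by rewrite -fX -f1 (inj_eq inj_f).
  by apply/eqP; rewrite eqn_dvd !order_dvdn fX1 -(fX1 #[f x]) !expg_order !eqxx.
apply: (num_pclasses_invariant (t := fun x => f x ^: [set: rT])) => [x|x y _ _|C].
- by rewrite mem_pclasses f_elt.
- rewrite eq_sym; apply/eqP/idP => [/class_eqP/imsetP[z _ e]|/imsetP[z _ ->]].
    rewrite -(f'K z) -fJ in e; rewrite (inj_f _ _ e) memJ_class ?inE //.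
  by rewrite fJ classGidl ?inE.
rewrite inE => /andP[/imsetP[y _ ->] /forall_inP pC]; exists (f' y); last by rewrite f'K.
by rewrite -f_elt f'K pC ?class_refl.
Qed.

End PClasses.

(** * The p-classes of the wreath product *)

Section CycleTypes.
Local Open Scope nat_scope.
Variables (gT : finGroupType) (p N : nat).
Hypothesis p_pr : prime p.

Definition colour : finType := {C | C \in pclasses p gT}.

(** The function a stands for the partition with a d parts equal to p ^ d. *)
Definition weight (a : {ffun 'I_N.+1 -> 'I_N.+1}) : nat := \sum_(d < N.+1) p ^ d * a d.

Definition total (m : {ffun colour -> {ffun 'I_N.+1 -> 'I_N.+1}}) : nat :=
  \sum_C weight (m C).

Section Size.
Variable n : nat.
Hypothesis le_nN : n <= N.
Implicit Types (w : wreath gT n) (x : colour * 'I_N.+1).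

Definition ppts w x : {set 'I_n} := pts w (p ^ x.2) (val x.1).

(** Dividing the number of points by p ^ d gives the number of cycles; it is at
    most n <= N, so that [inord] does not truncate it. *)
Definition cycle_type w : {ffun colour -> {ffun 'I_N.+1 -> 'I_N.+1}} :=
  [ffun C => [ffun d => inord (#|ppts w (C, d)| %/ p ^ d)]].

Lemma colour_class (C : colour) : val C \in classes [set: gT].
Proof. by have := valP C; rewrite inE => /andP[]. Qed.

Lemma ppts_inj w i x y : i \in ppts w x -> i \in ppts w y -> x = y.
Proof.
case: x y => [C d] [C' d']; rewrite !inE /= => /andP[/eqP -> iC] /andP[e iC'].
have -> : d = d' by apply/val_inj/eqP; rewrite -(eqn_exp2l _ _ (prime_gt1 p_pr)).
congr (_, _); apply: val_inj.
exact: (classes_eq (colour_class _) (colour_class _) iC iC').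
Qed.

(** Bounding the exponents by N loses no p-element: a cycle of length p ^ d has
    d < p ^ d <= n <= N. *)
Lemma pelt_ppts w : reflect (forall i, exists x, i \in ppts w x) (p.-elt w).
Proof.
rewrite pelt_wreath //; apply: (iffP forallP) => w_p i.
  have /andP[/p_natP[d len_d] pc] := w_p i; rewrite -mem_pclasses in pc.
  have lt_d : d < N.+1.
    have lt_dp := ltn_expl d (prime_gt1 p_pr); rewrite ltnS.
    apply: leq_trans (leq_trans (ltnW lt_dp) _) le_nN; rewrite -len_d.
    by rewrite -[n in _ <= n]card_ord max_card.
  by exists (exist _ (cyc w i ^: [set: gT]) pc : colour, Ordinal lt_d);
    rewrite inE /= len_d eqxx class_refl.
have [x] := w_p i; rewrite inE => /andP[/eqP -> cyc_x]; rewrite pnatX pnat_id //=.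
by have := valP x.1; rewrite inE => /andP[_ /forall_inP]; apply.
Qed.

Lemma cycle_typeE w C d : cycle_type w C d * p ^ d = #|ppts w (C, d)| :> nat.
Proof.
rewrite !ffunE inordK ?divnK ?dvdn_card_pts ?colour_class // ltnS.
apply: leq_trans (leq_div _ _) (leq_trans _ le_nN).
by rewrite -[n in _ <= n]card_ord max_card.
Qed.

(** Each point of a p-element lies in exactly one of the sets [ppts w x]. *)
Lemma total_cycle_type w : p.-elt w -> total (cycle_type w) = n.
Proof.
move/pelt_ppts=> w_p; pose ty i := xchoose (w_p i).
have tyE i x : (i \in ppts w x) = (ty i == x).
  apply/idP/eqP => [ix|<-]; last exact: (xchooseP (w_p i)).
  exact: ppts_inj (xchooseP (w_p i)) ix.
rewrite /total /weight pair_big -[RHS](card_ord n) -sum1_card.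
rewrite (partition_big ty xpredT) //=; apply: eq_bigr => -[C d] _ /=.
rewrite mulnC cycle_typeE -sum1_card; apply: eq_bigl => i.
by rewrite tyE.
Qed.

(** For p-elements the point counts that [cycle_type] does not record are 0, so
    that [wreath_conjP] applies. *)
Lemma cycle_type_conj w w' : p.-elt w -> p.-elt w' ->
  (cycle_type w == cycle_type w') = (w' \in w ^: [set: wreath gT n]).
Proof.
move=> /pelt_ppts wp /pelt_ppts w'p; apply/eqP/wreath_conjP => [e l C classC|e].
  have [/existsP[x /andP[/eqP -> /eqP ->]]|no_x] :=
    boolP [exists x : colour * 'I_N.+1, (l == p ^ x.2) && (C == val x.1)].
    case: x => x1 x2 /=; rewrite -[LHS](cycle_typeE w' x1 x2).
    by rewrite -[RHS](cycle_typeE w x1 x2) e.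
  suff pts0 v : (forall i, exists x, i \in ppts v x) -> #|pts v l C| = 0.
    by rewrite !pts0.
  move=> vp; apply: eq_card0 => i; apply: contraNF no_x => iC; have [x ix] := vp i.
  apply/existsP; exists x; move: iC ix; rewrite !inE => /andP[/eqP <- iC] /andP[-> ix].
  by rewrite (classes_eq classC (colour_class _) iC ix) eqxx.
apply/ffunP=> x; apply/ffunP=> d; rewrite !ffunE /ppts /= e //.
exact: colour_class.
Qed.

(** Each unit of multiplicity m C d becomes one cycle of length p ^ d whose product
    is a representative of C. *)
Lemma cycle_type_onto m : total m = n -> exists2 w, p.-elt w & cycle_type w = m.
Proof.
move=> tot_m; pose J := {x : colour * 'I_N.+1 & 'I_(m x.1 x.2)}.
pose l (j : J) := p ^ (tag j).2.
pose g (j : J) := repr (val (tag j).1).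
have l_gt0 j : 0 < l j by rewrite expn_gt0 prime_gt0.
have card_tag x : #|[set j : J | tag j == x]| = m x.1 x.2.
  rewrite cardsE -[RHS]card_ord.
  by rewrite (bij_eq_card (tag_with_bij (fun x => 'I_(m x.1 x.2)) x)) card_sig.
have sum_tag (x : colour * 'I_N.+1) :
    \sum_(j : J | tag j == x) l j = p ^ x.2 * m x.1 x.2.
  rewrite -card_tag -sum1_card big_distrr /=; apply: eq_big => j; first by rewrite inE.
  by move=> /eqP <-; rewrite muln1.
have sum_l : \sum_j l j = n.
  rewrite -tot_m /total /weight pair_big /=.
  rewrite (partition_big (fun j : J => tag j) xpredT) //=.
  by apply: eq_bigr => x _; rewrite sum_tag.
have [w [k [len_w cyc_w card_k]]] := ex_wreath_cycles g l_gt0 sum_l.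
have k_ppts i : i \in ppts w (tag (k i)).
  by rewrite inE len_w eqxx -(class_repr (colour_class _)) cyc_w.
exists w; first by apply/pelt_ppts=> i; exists (tag (k i)).
apply/ffunP=> C; apply/ffunP=> d; apply/val_inj/eqP.
have pd_gt0 : 0 < p ^ d by rewrite expn_gt0 prime_gt0.
rewrite -(eqn_pmul2r pd_gt0) cycle_typeE mulnC -(sum_tag (C, d)); apply/eqP.
rewrite -sum1_card (partition_big k (fun j => tag j == (C, d))) /=; last first.
  by move=> i iCd; rewrite (ppts_inj (k_ppts i) iCd).
apply: eq_bigr => j /eqP tag_j; rewrite -card_k -sum1_card; apply: eq_bigl => i.
rewrite inE andb_idl // => /eqP kij; have := k_ppts i.
by rewrite kij tag_j.
Qed.

Theorem num_pclasses_wreath :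
  num_pclasses p [set: wreath gT n] =
  #|[set m : {ffun colour -> {ffun 'I_N.+1 -> 'I_N.+1}} | total m == n]|.
Proof.
apply: (num_pclasses_invariant (t := cycle_type)) => [w pw|w w' |m].
- by rewrite inE total_cycle_type.
- exact: cycle_type_conj.
by rewrite inE => /eqP/cycle_type_onto.
Qed.

End Size.

End CycleTypes.

(** * The symmetric group as the wreath product of a trivial group *)

Section Trivial.
Variables (aT : finGroupType) (p : nat).
Hypothesis (aT1 : forall x : aT, x = 1).

Lemma card_colour_trivial : #|colour aT p| = 1%N.
Proof.
rewrite card_sig (eq_card1 (x := 1 ^: [set: aT])) // => C; rewrite !inE.
apply/idP/eqP => [|->].
  by case/andP=> /imsetP[x _ ->] _; rewrite [x]aT1.
by have := mem_pclasses p (1 : aT); rewrite inE => ->; rewrite /p_elt order1.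
Qed.

Lemma num_pclasses_sym n :
  num_pclasses p [set: 'S_n] = num_pclasses p [set: wreath aT n].
Proof.
pose f (s : 'S_n) : wreath aT n := wreath_of s (fun=> 1).
apply: (num_pclasses_bij_morph p (f := f)) => [s t|].
  apply: wreath_eq => i; first by rewrite topM !top_wreath_of.
  by rewrite [LHS]aT1 [RHS]aT1.
exists (@top aT n) => [s|w]; first exact: top_wreath_of.
apply: wreath_eq => i; first by rewrite top_wreath_of.
by rewrite [LHS]aT1 [RHS]aT1.
Qed.

End Trivial.

(** * Generating functions *)

Section GeneratingFunctions.
Import GRing.Theory.
Local Open Scope ring_scope.

(** Coefficients up to degree N of a power of a series depend only on those of the
    series, so a polynomial that agrees with it up to that degree may replace it. *)
Lemma fps_exp_poly (R : nzRingType) (f : fps R) (P : {poly R}) (N : nat) :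
    (forall i, (i <= N)%N -> f i = P`_i) ->
  forall m i, (i <= N)%N -> fps_exp f m i = (P ^+ m)`_i.
Proof.
move=> fP; elim=> [|m IH] i le_i; first by rewrite coef1.
rewrite exprS coefM {1}/fps_exp iterS -/(fps_exp f m) /fps_mul; apply: eq_bigr => j _.
by rewrite fP ?IH // (leq_trans _ le_i) ?leq_subr // -ltnS.
Qed.

Variables (p N : nat).
Hypothesis p_pr : prime p.

(** Up to degree N, the generating function of partitions into powers of p. *)
Definition partition_poly : {poly int} :=
  \sum_(a : {ffun 'I_N.+1 -> 'I_N.+1}) 'X^(weight p a).

Lemma coef_sumXn (I : finType) (e : I -> nat) (n : nat) :
  (\sum_i 'X^(e i) : {poly int})`_n = #|[set i | e i == n]|%:R.
Proof.
rewrite coef_sum -sum1_card natr_sum [RHS]big_mkcond /=; apply: eq_bigr => i _.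
by rewrite coefXn inE eq_sym; case: eqP.
Qed.

(** Distributing the product over the p-classes C of G of the sums
    \sum_a X ^ (weight a) chooses one partition for every C; the exponents add up
    to [total]. *)
Lemma ogf_wreath_poly (gT : finGroupType) n : (n <= N)%N ->
  ogf_wreath p gT n = (partition_poly ^+ #|colour gT p|)`_n.
Proof.
move=> le_nN; rewrite /ogf_wreath (num_pclasses_wreath _ p_pr le_nN) -coef_sumXn.
suff -> : partition_poly ^+ #|colour gT p| =
    \sum_(m : {ffun colour gT p -> {ffun 'I_N.+1 -> 'I_N.+1}}) 'X^(total m) by [].
rewrite -prodr_const /partition_poly (eq_bigl xpredT) // bigA_distr_bigA /=.
by apply: eq_bigr => m _; rewrite prodrXr.
Qed.

End GeneratingFunctions.

Theorem corollary5p3 (gT : finGroupType) (p : nat) (p_pr : prime p) :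
  ogf_wreath p gT =1 fps_exp (ogf_sym p) (num_pclasses p [set: gT]%G).
Proof.
move=> n.
(* 'S_0 serves as the trivial group. *)
have triv (x : 'S_0) : x = 1 by apply/permP=> -[].
rewrite (ogf_wreath_poly p_pr gT (leqnn n)) card_sig.
apply/esym/fps_exp_poly/leqnn => i le_in.
rewrite /ogf_sym (num_pclasses_sym p triv) -/(ogf_wreath p _ i).
by rewrite (ogf_wreath_poly p_pr _ le_in) (card_colour_trivial p triv) GRing.expr1.
Qed.
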